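(* Let $m\ge1$, $k\ge1$ and $h\le k-1$ be integers. The generating function for the number of partitions $\lambda$ of $n$ into distinct parts with an $h$-fixed hook in the $m$th column that arises from a hook of size $k$ (i.e. the row $s=k-h$ satisfies $\lambda_s\ge m$ and $h_{s,m}(\lambda)=k$) is \[ \sum_{l=\lceil (k+1)/2\rceil}^{k}\frac{q^{k+l(k-h-1)+(m-1)(2k-h-l)+\binom{k-h}{2}+\binom{k-l}{2}}\,(-q;q)_{m-1}}{(q;q)_{k-h-1}}\binom{l-1}{k-l}_q . \]
   Context: For a partition $\lambda$ with conjugate $\lambda'$, $h_{i,j}(\lambda)=\lambda_i+\lambda'_j-i-j+1$ is the hook length of cell $(i,j)$, $j\le\lambda_i$. An $h$-fixed hook in the $m$th column is a row $i$ with $\lambda_i\ge m$ and $h_{i,m}(\lambda)=i+h$. Notation: $(a;b)_n=\prod_{t=0}^{n-1}(1-ab^t)$, $\binom{a}{b}_q=\frac{(q;q)_a}{(q;q)_b(q;q)_{a-b}}$, and $\binom{x}{2}=x(x-1)/2$. *)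

(* Defs.v *)
From HB Require Import structures.
From mathcomp Require Import all_boot all_order all_algebra.
From mathcomp Require Import boolp.

Set Implicit Arguments.
Unset Strict Implicit.
Unset Printing Implicit Defensive.

Import Order.TTheory GRing.Theory Num.Theory.

Local Open Scope ring_scope.

Record fps (R : Type) : Type := Fps { fcoef : nat -> R }.

Section FpsRing.
Variable R : comUnitRingType.
Implicit Types f g : fps R.

HB.instance Definition _ := gen_eqMixin (fps R).
HB.instance Definition _ := gen_choiceMixin (fps R).

Lemma fpsP f g : (forall n, fcoef f n = fcoef g n) <-> f = g.
Proof.
split=> [|-> //]; case: f g => [f] [g] /= fg.
by congr Fps; apply/funext.
Qed.

Definition fps_zero : fps R := Fps (fun _ => 0).
Definition fps_opp f : fps R := Fps (fun n => - fcoef f n).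
Definition fps_add f g : fps R := Fps (fun n => fcoef f n + fcoef g n).
Definition fps_one : fps R := Fps (fun n => (n == 0%N)%:R).
Definition fps_mul f g : fps R :=
  Fps (fun n => \sum_(i < n.+1) fcoef f i * fcoef g (n - i)).

Fact fps_addA : associative fps_add.
Proof. by move=> f g e; apply/fpsP => n /=; rewrite addrA. Qed.
Fact fps_addC : commutative fps_add.
Proof. by move=> f g; apply/fpsP => n /=; rewrite addrC. Qed.
Fact fps_add0 : left_id fps_zero fps_add.
Proof. by move=> f; apply/fpsP => n /=; rewrite add0r. Qed.
Fact fps_addN : left_inverse fps_zero fps_opp fps_add.
Proof. by move=> f; apply/fpsP => n /=; rewrite addNr. Qed.

HB.instance Definition _ :=
  GRing.isZmodule.Build (fps R) fps_addA fps_addC fps_add0 fps_addN.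

Fact fps_mulC : commutative fps_mul.
Proof.
move=> f g; apply/fpsP => n /=; rewrite (reindex_inj rev_ord_inj) /=.
by apply: eq_bigr => j _; rewrite subSS (subKn (leq_ord j)) mulrC.
Qed.

Fact fps_mulA : associative fps_mul.
Proof.
move=> p q r; rewrite [fps_mul q r]fps_mulC; apply/fpsP => i /=.
pose coef3 j k := fcoef p j * (fcoef q (i - j - k) * fcoef r k).
transitivity (\sum_(j < i.+1) \sum_(k < i.+1 | (k <= i - j)%N) coef3 j k).
  apply: eq_bigr => /= j _; rewrite big_distrr /=.
  rewrite (big_ord_narrow_leq (leq_subr _ _)).
  by apply: eq_bigr => k _; rewrite /coef3 /= [fcoef r k * _]mulrC.
rewrite (exchange_big_dep predT) //= [RHS](reindex_inj rev_ord_inj) /=.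
apply: eq_bigr => k _; rewrite subSS (subKn (leq_ord k)).
transitivity (\sum_(j < i.+1 | (j <= i - k)%N) coef3 j k).
  apply: eq_bigl => j; rewrite -ltnS -(ltnS j) -!subSn ?leq_ord //.
  by rewrite -subn_gt0 -(subn_gt0 j) -!subnDA addnC.
rewrite (big_ord_narrow_leq (leq_subr _ _)) big_distrl /=.
by apply: eq_bigr => j _; rewrite /coef3 -!subnDA addnC mulrA.
Qed.

Fact fps_mul1 : left_id fps_one fps_mul.
Proof.
move=> f; apply/fpsP => n /=; rewrite big_ord_recl subn0 mul1r.
by rewrite big1 ?addr0 // => i _; rewrite mul0r.
Qed.

Fact fps_mulDl : left_distributive fps_mul fps_add.
Proof.
move=> f g e; apply/fpsP => n /=; rewrite -big_split.
by apply: eq_bigr => i _; rewrite mulrDl.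
Qed.

Fact fps_1_neq0 : fps_one != 0 :> fps R.
Proof.
by apply/eqP => /fpsP /(_ 0%N) /= /eqP; rewrite oner_eq0.
Qed.

HB.instance Definition _ := GRing.Zmodule_isComNzRing.Build (fps R)
  fps_mulA fps_mulC fps_mul1 fps_mulDl fps_1_neq0.

Lemma fcoef0 n : fcoef (0 : fps R) n = 0. Proof. by []. Qed.
Lemma fcoef1 n : fcoef (1 : fps R) n = (n == 0%N)%:R. Proof. by []. Qed.
Lemma fcoefN f n : fcoef (- f) n = - fcoef f n. Proof. by []. Qed.
Lemma fcoefD f g n : fcoef (f + g) n = fcoef f n + fcoef g n.
Proof. by []. Qed.
Lemma fcoefM f g n :
  fcoef (f * g) n = \sum_(i < n.+1) fcoef f i * fcoef g (n - i).
Proof. by []. Qed.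
Lemma fcoef_sum I (r : seq I) (P : pred I) (F : I -> fps R) n :
  fcoef (\sum_(i <- r | P i) F i) n = \sum_(i <- r | P i) fcoef (F i) n.
Proof. exact: (big_morph (fun f => fcoef f n) (fun f g => fcoefD f g n)). Qed.

Definition fpsC (c : R) : fps R := Fps (fun n => if n == 0%N then c else 0).

Lemma fcoefCM c f n : fcoef (fpsC c * f) n = c * fcoef f n.
Proof.
rewrite fcoefM big_ord_recl subn0 /= big1 ?addr0 // => i _.
by rewrite mul0r.
Qed.

Lemma fcoefX_eq0 f j n : fcoef f 0 = 0 -> (n < j)%N -> fcoef (f ^+ j) n = 0.
Proof.
move=> f0; elim: j n => // j IHj n ltnj; rewrite exprS fcoefM big1 // => i _.
have [->|i_gt0] := posnP i; first by rewrite f0 mul0r.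
rewrite IHj ?mulr0 // -(ltn_add2r i) subnK ?leq_ord //.
by rewrite (leq_trans ltnj) // -addn1 leq_add2l.
Qed.

Definition fps_unit : pred (fps R) := [pred f | fcoef f 0 \is a GRing.unit].

(* Writing f = f_0 (1 - u) with u of zero constant term, the inverse of f is
   f_0^-1 (1 + u + u^2 + ...), where u ^+ j only contributes to the
   coefficients of index at least j. *)
Definition fps_inv f : fps R :=
  if f \in fps_unit then
    let u := 1 - fpsC (fcoef f 0)^-1 * f in
    Fps (fun n => (fcoef f 0)^-1 * \sum_(j < n.+1) fcoef (u ^+ j) n)
  else f.

Fact fps_mulVr : {in fps_unit, left_inverse 1 fps_inv *%R}.
Proof.
move=> f uf; rewrite /fps_inv uf; move: uf; rewrite inE => uf.
set c := fcoef f 0 in uf *; set u := 1 - _.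
have u0 : fcoef u 0 = 0.
  by rewrite fcoefD fcoefN fcoef1 eqxx fcoefCM mulVr // subrr.
pose S := Fps (fun n => \sum_(j < n.+1) fcoef (u ^+ j) n).
have -> : Fps (fun n => c^-1 * \sum_(j < n.+1) fcoef (u ^+ j) n) = fpsC c^-1 * S.
  by apply/fpsP => n; rewrite fcoefCM.
rewrite mulrAC mulrC -[fpsC _ * f](subKr 1) -/u.
apply/fpsP => n.
have -> : fcoef (S * (1 - u)) n = fcoef ((\sum_(j < n.+1) u ^+ j) * (1 - u)) n.
  rewrite !fcoefM; apply: eq_bigr => i _; congr (_ * _); rewrite fcoef_sum /=.
  rewrite (big_ord_widen n.+1 (fun j => fcoef (u ^+ j) i)) // big_mkcond /=.
  by apply: eq_bigr => j _; case: ltnP => // ij; rewrite fcoefX_eq0.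
rewrite mulrC -opprB mulNr -subrX1 opprB fcoefD fcoefN fcoefX_eq0 //.
by rewrite subr0.
Qed.

Fact fps_unitPl f g : g * f = 1 -> fps_unit f.
Proof.
move=> /fpsP /(_ 0%N); rewrite fcoefM big_ord1 fcoef1 eqxx /= => gf.
by rewrite /fps_unit /=; apply/unitrPr; exists (fcoef g 0); rewrite mulrC.
Qed.

Fact fps_inv_out : {in [predC fps_unit], fps_inv =1 id}.
Proof. by move=> f; rewrite inE /= /fps_inv => /negbTE ->. Qed.

HB.instance Definition _ := GRing.ComNzRing_hasMulInverse.Build (fps R)
  fps_mulVr fps_unitPl fps_inv_out.

Definition fpsX : fps R := Fps (fun n => (n == 1%N)%:R).

End FpsRing.

Arguments fpsX {R}.

Definition gen_fun (a : nat -> nat) : fps int := Fps (fun n => (a n)%:Z).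

Definition qpoch (A : comNzRingType) (a b : A) (n : nat) : A :=
  \prod_(0 <= t < n) (1 - a * b ^+ t).

(* Intended for b <= a only: a - b is truncated. *)
Definition qbinom (A : comUnitRingType) (q : A) (a b : nat) : A :=
  qpoch q q a / (qpoch q q b * qpoch q q (a - b)).

Definition binom2 (x : int) : int := (x * (x - 1) %/ 2)%Z.

Definition is_partition (la : seq nat) : bool :=
  sorted geq la && (0%N \notin la).

Definition distinct_parts (la : seq nat) : bool := uniq la.

(* Rows and columns are numbered from 1. *)
Definition part (la : seq nat) (i : nat) : nat := nth 0%N la i.-1.

Definition conj_part (la : seq nat) (j : nat) : nat :=
  count (fun p => (j <= p)%N) la.

Definition hook (la : seq nat) (i j : nat) : int :=
  (part la i)%:Z + (conj_part la j)%:Z - i%:Z - j%:Z + 1.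

Definition fixed_hook (h : int) (m : nat) (la : seq nat) (i : nat) : bool :=
  (m <= part la i)%N && (hook la i m == i%:Z + h).

Definition has_fixed_hook_from (h : int) (m k : nat) (la : seq nat) : bool :=
  has (fun i => fixed_hook h m la i && (hook la i m == k%:Z))
      (iota 1 (size la)).

(* A partition of n has at most n parts, each at most n, so that it is the
   image of a unique element of n.-bseq 'I_n.+1; see count_partitionsE. *)
Definition count_partitions (P : pred (seq nat)) (n : nat) : nat :=
  #|[set p : n.-bseq 'I_n.+1 |
      let la := map val p in [&& is_partition la, sumn la == n & P la]]|.

Lemma count_partitionsE (P : pred (seq nat)) (n : nat) (s : seq (seq nat)) :
  uniq s ->
  (forall la, (la \in s) = [&& is_partition la, sumn la == n & P la]) ->
  count_partitions P n = size s.
Proof.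
move=> us sP; pose f (p : n.-bseq 'I_n.+1) : seq nat := map val p.
have f_inj : injective f.
  by move=> p p' /(inj_map val_inj)/val_inj.
rewrite /count_partitions cardE -(size_map f).
apply/eqP; rewrite -uniq_size_uniq ?map_inj_uniq ?enum_uniq // => la.
rewrite sP; apply/idP/mapP => [Pla | [p]]; last by rewrite mem_enum inE => ? ->.
have /and3P[/andP[_ la0] /eqP lan _] := Pla.
have le_n x : x \in la -> (x < n.+1)%N.
  by rewrite ltnS -lan => /perm_to_rem/perm_sumn -> /=; rewrite leq_addr.
have sz_la : (size la <= n)%N.
  rewrite -lan; elim: la la0 {Pla lan le_n} => //= x la IHla.
  rewrite inE negb_or eq_sym -lt0n => /andP[x0 /IHla sz_la].
  by rewrite -add1n leq_add.
have sz_la' : (size (map (@inord n) la) <= n)%N by rewrite size_map.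
have laE : f (Bseq sz_la') = la.
  rewrite /f /= -map_comp -[RHS]map_id.
  by apply/eq_in_map => x /le_n ltxn /=; rewrite inordK.
by exists (Bseq sz_la'); rewrite // mem_enum inE -/(f _) laE.
Qed.

(* Main.v *)
(** In a partition into distinct parts with the required hook in row [s], write
    [m + l - 1] for the part in row [s].  The parts above it form an arbitrary
    [(s-1)]-set of integers larger than [m + l - 1], the leg of the hook is a
    [(k-l)]-set of integers in [[m, m+l-2]], and the remaining parts form an
    arbitrary set of integers below [m]; these three choices are independent and
    give the three factors of the summand.  Since the coefficient of [q^n] only
    involves parts at most [N] for any large [N], the partitions are enumerated
    as the subsequences of [N, ..., 2, 1], and the unbounded set of large parts
    is counted by a Gaussian binomial that agrees with [1/(q;q)_(s-1)] modulo
    [q^(n+1)]. *)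
Require Import Defs.
From mathcomp Require Import all_boot all_order all_algebra.
From mathcomp Require Import zify ring.

Import Order.TTheory GRing.Theory Num.Theory.
Local Open Scope ring_scope.

(** * Enumerating subsequences *)

(** An explicit list is used so that sums over it split along cons and concatenation. *)
Fixpoint subseqs (T : Type) (s : seq T) : seq (seq T) :=
  if s is x :: s' then [seq x :: t | t <- subseqs T s'] ++ subseqs T s'
  else [:: [::]].
Arguments subseqs {T} s.

Lemma mem_subseqs (T : eqType) (s t : seq T) : (t \in subseqs s) = subseq t s.
Proof.
elim: s t => [|x s IHs] t; first by rewrite inE; case: t.
rewrite mem_cat IHs; case: t => [|y t] /=; first by rewrite sub0seq orbT.
case: eqP => [->|neq_yx].
  rewrite mem_map ?IHs; last by move=> ? ? [].
  by apply/orb_idr/subseq_trans/subseq_cons.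
by apply/orb_idl => /mapP[? _ [/neq_yx]].
Qed.

Lemma uniq_subseqs (T : eqType) (s : seq T) : uniq s -> uniq (subseqs s).
Proof.
elim: s => //= x s IHs /andP[xs /IHs us].
rewrite cat_uniq map_inj_uniq ?us ?andbT /=; last by move=> ? ? [].
apply/hasPn => t; rewrite mem_subseqs => /mem_subseq ts; apply/mapP => -[u _ tE].
by move: xs; rewrite ts // tE mem_head.
Qed.

Lemma big_subseqs_cat (T : Type) (A : nmodType) (P : pred (seq T))
    (F : seq T -> A) (s1 s2 : seq T) :
  \sum_(t <- subseqs (s1 ++ s2) | P t) F t =
  \sum_(a <- subseqs s1) \sum_(b <- subseqs s2 | P (a ++ b)) F (a ++ b).
Proof.
elim: s1 P F => [|x s1 IHs] P F /=; first by rewrite big_seq1.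
by rewrite !big_cat !big_map /= !IHs.
Qed.

Lemma rev_iotaS (a n : nat) : rev (iota a n.+1) = (a + n)%N :: rev (iota a n).
Proof. by rewrite -addn1 iotaD rev_cat. Qed.

Lemma rev_iotaD (a n1 n2 : nat) :
  rev (iota a (n1 + n2)) = rev (iota (a + n1) n2) ++ rev (iota a n1).
Proof. by rewrite iotaD rev_cat. Qed.

(** A strictly decreasing list is determined by its members, so [la] equals the interval filtered by
    membership in [la]. *)
Lemma subseq_rev_iota1 (la : seq nat) (N : nat) :
  subseq la (rev (iota 1 N)) =
  [&& sorted gtn la, 0%N \notin la & all (leq^~ N) la].
Proof.
have gtn_tr : transitive gtn by move=> y x z /=; lia.
have sN : sorted gtn (rev (iota 1 N)) by rewrite rev_sorted iota_ltn_sorted.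
apply/idP/and3P => [sub | [s_la la0 /allP laN]].
  have memN x : x \in la -> (0 < x <= N)%N.
    by move/(mem_subseq sub); rewrite mem_rev mem_iota; lia.
  split; first exact: subseq_sorted sub sN.
    by apply/negP => /memN.
  by apply/allP => x /memN/andP[].
suff -> : la = [seq x <- rev (iota 1 N) | x \in la] by apply: filter_subseq.
apply: (irr_sorted_eq gtn_tr _ s_la); first by move=> x /=; apply: ltnn.
  exact: sorted_filter.
move=> x; rewrite mem_filter mem_rev mem_iota; apply/idP/andP => [xla|[]//].
split=> //; have := laN x xla; case: x xla => [|x]; last by lia.
by rewrite (negbTE la0).
Qed.

(** * Subsets of an interval, weighted by their sum *)

Lemma sum_subseqs_pow (A : comNzRingType) (q : A) (n : nat) :
  \sum_(d <- subseqs (rev (iota 1 n))) q ^+ sumn d = qpoch (- q) q n.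
Proof.
rewrite /qpoch; elim: n => [|n IHn]; first by rewrite big_seq1 big_geq.
rewrite rev_iotaS big_cat big_map big_nat_recr //= -IHn.
under eq_bigr do rewrite exprD.
by rewrite -mulr_sumr mulNr -exprS; ring.
Qed.

Lemma qpochS (A : comNzRingType) (a b : A) (n : nat) :
  qpoch a b n.+1 = qpoch a b n * (1 - a * b ^+ n).
Proof. by rewrite /qpoch big_nat_recr. Qed.

Lemma sum_subseqs_size_gt (A : comNzRingType) (q : A) (s : seq nat) (j : nat) :
  (size s < j)%N -> \sum_(c <- subseqs s | size c == j) q ^+ sumn c = 0.
Proof.
move=> lt_sj; rewrite big_seq_cond big1 // => c /andP[].
by rewrite mem_subseqs => /size_subseq + /eqP size_c; rewrite size_c leqNgt lt_sj.
Qed.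

Lemma sum_subseqs_size0 (A : comNzRingType) (q : A) (s : seq nat) :
  \sum_(c <- subseqs s | size c == 0%N) q ^+ sumn c = 1.
Proof.
elim: s => [|x s IHs] /=; first by rewrite big_cons big_nil addr0.
by rewrite big_cat big_map /= big_pred0_eq add0r.
Qed.

(** The Gaussian binomial with denominators cleared, so that it makes sense in any commutative ring.
    The induction is the q-Pascal rule: either the largest element [a + n] is chosen or it is
    not. *)
Lemma sum_subseqs_size (A : comNzRingType) (q : A) (a n j : nat) :
  (j <= n)%N ->
  (\sum_(c <- subseqs (rev (iota a n)) | size c == j) q ^+ sumn c)
    * (qpoch q q j * qpoch q q (n - j))
  = q ^+ (a * j + 'C(j, 2)) * qpoch q q n.
Proof.
elim: n j => [|n IHn] [|j] // le_jn.
- by rewrite sum_subseqs_size0 muln0 subn0 /qpoch !big_geq // !mulr1.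
- by rewrite sum_subseqs_size0 muln0 subn0 /qpoch [\prod_(0 <= _ < 0) _]big_geq // !mul1r.
rewrite rev_iotaS big_cat big_map /=.
under eq_bigr do rewrite exprD.
rewrite -mulr_sumr subSS mulrDl.
rewrite binS bin1.
have -> : q ^+ (a + n)%N * (\sum_(c <- subseqs (rev (iota a n)) | size c == j) q ^+ sumn c)
    * (qpoch q q j.+1 * qpoch q q (n - j))
  = q ^+ (a + n)%N * (1 - q * q ^+ j) * (q ^+ (a * j + 'C(j, 2)) * qpoch q q n).
  by rewrite -IHn // qpochS; ring.
have -> : (\sum_(c <- subseqs (rev (iota a n)) | size c == j.+1) q ^+ sumn c)
    * (qpoch q q j.+1 * qpoch q q (n - j))
  = (1 - q ^+ (n - j)) * (q ^+ (a * j.+1 + 'C(j.+1, 2)) * qpoch q q n).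
  have [lt_jn|] := ltnP j n; last first.
    move=> le_nj; rewrite sum_subseqs_size_gt ?size_rev ?size_iota //.
    by rewrite (_ : n - j = 0)%N ?expr0 ?subrr ?mul0r //; lia.
  rewrite -(IHn j.+1) //; have -> : (n - j = (n - j.+1).+1)%N by lia.
  by rewrite (qpochS _ _ _ (n - j.+1)) exprS; ring.
rewrite qpochS binS bin1.
(* This removes the truncated subtraction from the exponents. *)
have [r ->] : exists r, n = (j + r)%N by exists (n - j)%N; lia.
by rewrite addKn mulnS !exprD; ring.
Qed.

(** * Truncation modulo powers of q *)

(** Each of the last [d] factors is 1 modulo [q ^+ r.+1]. *)
Lemma qpoch_addn (A : comNzRingType) (q : A) (r d : nat) :
  exists u, qpoch q q (r + d) = qpoch q q r * (1 + q ^+ r.+1 * u).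
Proof.
elim: d => [|d [u IHd]]; first by exists 0; rewrite addn0 mulr0 addr0 mulr1.
(* Read off from expanding [(1 + q ^+ r.+1 * u) * (1 - q ^+ (r + d).+1)]. *)
exists (u - q ^+ d - q ^+ r.+1 * u * q ^+ d).
by rewrite addnS qpochS IHd exprD exprS; ring.
Qed.

Lemma fcoefXM (R : comUnitRingType) (f : fps R) (n : nat) :
  fcoef (fpsX * f) n = if n is n'.+1 then fcoef f n' else 0.
Proof.
case: n => [|n]; first by rewrite fcoefM big_ord1 mul0r.
rewrite fcoefM big_ord_recl mul0r add0r big_ord_recl mul1r subn1 /=.
by rewrite big1 ?addr0 // => i _; rewrite mul0r.
Qed.

Lemma fcoefXn (R : comUnitRingType) (j n : nat) :
  fcoef ((fpsX : fps R) ^+ j) n = (n == j)%:R.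
Proof. by elim: j n => // j IHj n; rewrite exprS fcoefXM; case: n. Qed.

Lemma fcoefXnM_lt (R : comUnitRingType) (f : fps R) (j n : nat) :
  (n < j)%N -> fcoef (fpsX ^+ j * f) n = 0.
Proof.
move=> lt_nj; rewrite fcoefM big1 // => i _; rewrite fcoefXn.
by rewrite (_ : (i == j :> nat) = false) ?mul0r //; apply/eqP; have := ltn_ord i; lia.
Qed.

Lemma qpochX_unit (R : comUnitRingType) (n : nat) :
  qpoch (fpsX : fps R) fpsX n \is a GRing.unit.
Proof.
rewrite /qpoch; apply: rpred_prod => t _; apply: (_ : fps_unit _).
by rewrite /fps_unit inE fcoefD fcoefN fcoefXM subr0 fcoef1 unitr1.
Qed.

(** In the Gaussian binomial, the ratio of [qpoch q q n] to [qpoch q q (n - j)] is 1 modulo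
    [q ^+ (n - j).+1], which leaves only [qpoch q q j] in the denominator. *)
Lemma sum_subseqs_size_approx (R : comUnitRingType) (a n j : nat) :
  let q : fps R := fpsX in
  (j <= n)%N ->
  exists u, \sum_(c <- subseqs (rev (iota a n)) | size c == j) q ^+ sumn c =
            q ^+ (a * j + 'C(j, 2)) / qpoch q q j + q ^+ (n - j).+1 * u.
Proof.
move=> q le_jn; set e := q ^+ (_ + _).
have [u Eu] := qpoch_addn _ q (n - j) j.
exists (e * u / qpoch q q j).
have Uj : qpoch q q j \is a GRing.unit by apply: qpochX_unit.
have Ur : qpoch q q (n - j) \is a GRing.unit by apply: qpochX_unit.
apply: (mulIr (x := qpoch q q j * qpoch q q (n - j))); first by rewrite unitrMl.
rewrite sum_subseqs_size // -/e -{1}(subnK le_jn) Eu.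
have := mulVr Uj; set V := _^-1; set Qj := qpoch q q j => VQ.
transitivity (e * qpoch q q (n - j) * (V * Qj) * (1 + q ^+ (n - j).+1 * u)).
  by rewrite VQ; ring.
by ring.
Qed.

(** * From hooks to conditions on decreasing lists *)

Lemma gen_fun_distinct (P : pred (seq nat)) (n N : nat) :
  (n <= N)%N ->
  fcoef (gen_fun (count_partitions (fun la => distinct_parts la && P la))) n =
  fcoef (\sum_(la <- subseqs (rev (iota 1 N)) | P la) fpsX ^+ sumn la) n.
Proof.
move=> le_nN /=.
rewrite (@count_partitionsE _ _
  [seq la <- subseqs (rev (iota 1 N)) | (sumn la == n) && P la]).
- rewrite size_filter -sum1_count -natz natr_sum fcoef_sum.
  rewrite big_mkcondl [RHS]big_mkcond [LHS]big_mkcond; apply: eq_bigr => la _.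
  by rewrite fcoefXn eq_sym; case: ifP => // _; case: (n == sumn la).
- by apply/filter_uniq/uniq_subseqs; rewrite rev_uniq iota_uniq.
move=> la; rewrite mem_filter mem_subseqs subseq_rev_iota1 gtn_sorted_uniq_geq.
rewrite /is_partition /distinct_parts.
case: eqP => [la_n|_]; last by rewrite andbF.
have -> : all (leq^~ N) la.
  apply/allP => x /perm_to_rem/perm_sumn /= la_x.
  by apply: leq_trans le_nN; rewrite -la_n la_x leq_addr.
by case: (P la); case: (uniq la); case: (sorted geq la); case: (0%N \in la).
Qed.

Lemma count_geq_nth (la : seq nat) (m i : nat) :
  sorted gtn la -> (i < size la)%N -> (m <= nth 0%N la i)%N ->
  (i < count (fun p => m <= p)%N la)%N.
Proof.
elim: la i => // x la IHla [|i] /= x_la lt_i le_m; first by rewrite le_m.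
have gtn_tr : transitive gtn by move=> ? ? ? /=; lia.
have le_mx : (m <= x)%N.
  have /allP/(_ _ (mem_nth 0%N lt_i)) /= := order_path_min gtn_tr x_la; lia.
by rewrite le_mx ltnS IHla ?(path_sorted x_la).
Qed.

(** The two values prescribed for the hook force row [s.+1], so the quantifier over rows disappears.
    Rows count from 1 but [nth] from 0, hence index [s]. *)
Lemma has_fixed_hook_fromE (m k s : nat) (h : int) (la : seq nat) :
  h = k%:Z - s.+1%:Z ->
  has_fixed_hook_from h m k la =
  [&& (s < size la)%N, (m <= nth 0%N la s)%N &
      (nth 0%N la s + conj_part la m + 1 == s.+1 + m + k)%N].
Proof.
move=> hE; apply/hasP/and3P => [[i]|[lt_s le_m /eqP hook_s]].
  rewrite mem_iota /fixed_hook => i_la /andP[/andP[le_m /eqP hook_i] /eqP hook_k].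
  have iE : i = s.+1 by lia.
  move: hook_k le_m i_la; rewrite /hook /part iE /= => ? ? ?.
  by split; [lia|lia|apply/eqP; lia].
exists s.+1; first by rewrite mem_iota; lia.
have hookE : hook la s.+1 m = k%:Z by rewrite /hook /part /=; lia.
by rewrite /fixed_hook hookE eqxx andbT le_m /=; apply/eqP; lia.
Qed.

(** Only [l = nth 0 la s - m] can contribute, so the sum is an indicator. This [l] is positive
    because the row reaches column [m.+1], and at most [k] because that column has length at least
    [s.+1]. *)
Lemma sum_fixed_hook (A : nmodType) (m k s : nat) (h : int) (la : seq nat) (x : A) :
  h = k%:Z - s.+1%:Z -> sorted gtn la ->
  (if has_fixed_hook_from h m.+1 k la then x else 0) =
  \sum_(1 <= l < k.+1 | [&& (s < size la)%N, (nth 0%N la s == m + l)%N &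
                           (conj_part la m.+1 + l == s.+1 + k)%N]) x.
Proof.
move=> hE s_la; rewrite (has_fixed_hook_fromE _ _ _ _ _ hE).
case: ifP => [/and3P[lt_s le_m /eqP hook_s] | no_hook].
  have lt_sc : (s < conj_part la m.+1)%N by apply: count_geq_nth.
  rewrite (eq_bigl (fun l => l == nth 0%N la s - m)%N) => [|l]; last first.
    by rewrite lt_s /=; apply/andP/eqP; lia.
  rewrite big_nat1_eq ifT //; lia.
rewrite big_nat_cond big_pred0 // => l; apply/negbTE/negP.
by move/andP=> [l_k /and3P[lt_s nth_s conj_s]]; move/negP: no_hook; apply; lia.
Qed.

Lemma binom2_nat (n : nat) : binom2 n%:Z = 'C(n, 2)%:Z.
Proof.
rewrite /binom2; case: n => [|n]; first by rewrite bin0n.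
have -> : n.+1%:Z * (n.+1%:Z - 1) = 'C(n.+1, 2)%:Z * 2.
  have /= binE := bin_ffact n.+1 2; rewrite ffactnS ffactn1 in binE.
  by have -> : n.+1%:Z - 1 = n by [lia]; rewrite -PoszM -binE PoszM.
by rewrite mulzK.
Qed.

(** * Factorisation around the hook row *)

(** The interval is cut into the integers above [x], [x] itself, those strictly between [m] and [x],
    and those up to [m]; the hook condition only fixes how many are taken from the first and third
    blocks. *)
Lemma sum_subseqs_row (A : comNzRingType) (q : A) (m k s l n : nat) :
  let x := (m + l.+1)%N in
  \sum_(la <- subseqs (rev (iota 1 (m + l.+1 + n))) |
      [&& (s < size la)%N, (nth 0%N la s == m + l.+1)%N &
          (conj_part la m.+1 + l.+1 == s.+1 + k)%N]) q ^+ sumn la =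
  (\sum_(a <- subseqs (rev (iota x.+1 n)) | size a == s) q ^+ sumn a) * q ^+ x *
  (\sum_(c <- subseqs (rev (iota m.+1 l)) | (size c + l.+1 == k)%N) q ^+ sumn c) *
  (\sum_(d <- subseqs (rev (iota 1 m))) q ^+ sumn d).
Proof.
move=> x; pose P la := [&& (s < size la)%N, (nth 0%N la s == m + l.+1)%N &
                          (conj_part la m.+1 + l.+1 == s.+1 + k)%N].
under eq_bigl do rewrite -/(P _).
rewrite rev_iotaD [X in iota 1 X]addnS rev_iotaS rev_iotaD !add1n -(addnS m l) -/x.
set sA := rev (iota x.+1 n); set sC := rev (iota m.+1 l); set sD := rev (iota 1 m).
have subA (a : seq nat) : a \in subseqs sA -> all (fun y => x < y)%N a.
  rewrite mem_subseqs => /mem_subseq sub_a; apply/allP => y /sub_a.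
  by rewrite mem_rev mem_iota => /andP[].
have subC (c : seq nat) : c \in subseqs sC -> all (fun y => m < y < x)%N c.
  rewrite mem_subseqs => /mem_subseq sub_c; apply/allP => y /sub_c.
  by rewrite mem_rev mem_iota /x; lia.
have subD (d : seq nat) : d \in subseqs sD -> all (fun y => y <= m)%N d.
  rewrite mem_subseqs => /mem_subseq sub_d; apply/allP => y /sub_d.
  by rewrite mem_rev mem_iota; lia.
(* If [x] is not chosen, no row has length [x]. *)
have Pnotin (a b : seq nat) : a \in subseqs sA -> b \in subseqs (sC ++ sD) -> P (a ++ b) = false.
  move=> /subA/allP aP; rewrite mem_subseqs => /mem_subseq bP.
  apply/negP => /and3P[lt_s /eqP nth_s _].
  have := mem_nth 0%N lt_s; rewrite nth_s -/x mem_cat => /orP[/aP|/bP].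
    by rewrite ltnn.
  by rewrite mem_cat !mem_rev !mem_iota /x; lia.
(* If [x] is chosen, it sits at index [size a], and column [m.+1] meets exactly [a], [x] and [c]. *)
have Pin (a c d : seq nat) : a \in subseqs sA -> c \in subseqs sC -> d \in subseqs sD ->
    P (a ++ x :: c ++ d) = (size a == s) && (size c + l.+1 == k)%N.
  move=> /subA/allP aP /subC/allP cP /subD/allP dP.
  have conjE : conj_part (a ++ x :: c ++ d) m.+1 = (size a + (size c).+1)%N.
    rewrite /conj_part count_cat /= count_cat.
    have /eqP -> : (count (leq m.+1) a == size a)%N.
      by rewrite -all_count; apply/allP => y /aP; rewrite /x /=; lia.
    have /eqP -> : (count (leq m.+1) c == size c)%N.
      by rewrite -all_count; apply/allP => y /cP /=; lia.
    have /eqP -> : (count (leq m.+1) d == 0)%N.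
      rewrite -leqn0 leqNgt -has_count; apply/hasPn => y /dP /=; lia.
    by have -> : (m < x)%N by [rewrite /x; lia]; rewrite addn0.
  rewrite /P conjE size_cat /= size_cat nth_cat -/x.
  case: (ltngtP s (size a)) => [lt_sa|lt_as|s_a] /=.
  - have := aP _ (mem_nth 0%N lt_sa); case: eqP => [->|]; first by rewrite ltnn.
    by rewrite andbF.
  - have [t tE] : exists t, (s - size a = t.+1)%N by exists (s - size a).-1; lia.
    rewrite tE /=; apply/negP => /and3P[lt_s /eqP nth_t _].
    have lt_t : (t < size (c ++ d))%N by rewrite size_cat -ltnS -tE ltn_subLR // ltnW.
    have := mem_nth 0%N lt_t; rewrite nth_t mem_cat => /orP[/cP|/dP]; rewrite /x; lia.
  by rewrite s_a subnn /= eqxx; lia.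
transitivity (\sum_(a <- subseqs sA | size a == s)
    \sum_(c <- subseqs sC | (size c + l.+1 == k)%N)
    \sum_(d <- subseqs sD) q ^+ sumn (a ++ x :: c ++ d)).
  rewrite big_subseqs_cat [RHS]big_mkcond; apply: eq_big_seq => a sub_a.
  rewrite big_cat big_map big_subseqs_cat /=.
  rewrite [X in _ + X]big_seq_cond [X in _ + X]big_pred0 => [|b]; last first.
    by apply/negP => /andP[sub_b]; rewrite Pnotin.
  rewrite addr0; transitivity (\sum_(c <- subseqs sC)
      if (size a == s) && (size c + l.+1 == k)%N
      then \sum_(d <- subseqs sD) q ^+ sumn (a ++ x :: c ++ d) else 0).
    apply: eq_big_seq => c sub_c; rewrite big_mkcond.
    case: ifP => cond; first by apply: eq_big_seq => d sub_d; rewrite Pin // cond.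
    by rewrite big_seq big1 // => d sub_d; rewrite Pin // cond.
  by case: (size a == s) => /=; [rewrite -big_mkcond | rewrite big1].
rewrite !big_distrl /=; apply: eq_bigr => a _.
rewrite -mulrA big_distrlr big_distrr /=; apply: eq_bigr => c _.
rewrite big_distrr /=; apply: eq_bigr => d _.
by rewrite sumn_cat /= sumn_cat !exprD !mulrA.
Qed.

(** The bound on [N] leaves at least [s + n] integers above the hook row, so the truncation error is
    divisible by [q ^+ n.+1]. *)
Lemma fcoef_sum_subseqs_row (R : comUnitRingType) (m k s l n N : nat) :
  let q : fps R := fpsX in
  (0 < l <= k)%N -> (m + l + s + n <= N)%N ->
  fcoef (\sum_(la <- subseqs (rev (iota 1 N)) |
      [&& (s < size la)%N, (nth 0%N la s == m + l)%N &
          (conj_part la m.+1 + l == s.+1 + k)%N]) q ^+ sumn la) n =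
  fcoef (q ^+ ((m + l).+1 * s + 'C(s, 2)) / qpoch q q s * q ^+ (m + l) *
         (\sum_(c <- subseqs (rev (iota m.+1 l.-1)) | size c == (k - l)%N)
            q ^+ sumn c) *
         qpoch (- q) q m) n.
Proof.
move=> q; case: l => // l lt_lk le_N; rewrite -[l.+1.-1]/l.
have [d dE] : exists d, N = (m + l.+1 + d)%N by exists (N - (m + l.+1))%N; lia.
rewrite dE sum_subseqs_row sum_subseqs_pow.
have legE : (fun c : seq nat => (size c + l.+1 == k)%N) =1
            (fun c : seq nat => size c == (k - l.+1)%N).
  by move=> c; apply/eqP/eqP; lia.
rewrite (eq_bigl _ _ legE).
have [|u ->] := sum_subseqs_size_approx R (m + l.+1).+1 d s; first by lia.
rewrite -/q !mulrDl fcoefD -!mulrA [X in _ + X]fcoefXnM_lt ?addr0 //.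
by lia.
Qed.

Lemma sum_subseqs_size_qbinom (R : comUnitRingType) (a n j : nat) :
  let q : fps R := fpsX in
  (j <= n)%N ->
  \sum_(c <- subseqs (rev (iota a n)) | size c == j) q ^+ sumn c =
  q ^+ (a * j + 'C(j, 2)) * qbinom q n j.
Proof.
move=> q le_jn.
have Uq : qpoch q q j * qpoch q q (n - j) \is a GRing.unit.
  by rewrite unitrMl; apply: qpochX_unit.
by apply: (mulIr Uq); rewrite sum_subseqs_size // /qbinom -mulrA divrK.
Qed.

(** * Assembling the sum over [l] *)

Theorem theorem3p4 (m k : nat) (h : int)
    (hm : (1 <= m)%N) (hk : (1 <= k)%N) (hh : h <= k%:Z - 1) :
  let q : fps int := fpsX in
  gen_fun (count_partitions
    (fun la => distinct_parts la && has_fixed_hook_from h m k la)) =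
  \sum_(uphalf k.+1 <= l < k.+1)
    q ^ (k%:Z + l%:Z * (k%:Z - h - 1) + (m%:Z - 1) * (2 * k%:Z - h - l%:Z)
         + binom2 (k%:Z - h) + binom2 (k%:Z - l%:Z))
    * qpoch (- q) q (m - 1)
    / qpoch q q `|(k%:Z - h - 1)%R|%N
    * qbinom q (l - 1) (k - l).
Proof.
move=> q; apply/fpsP => n.
(* From here [m] denotes the number of columns to the left of the hook's column. *)
case: m hm => // m _.
have [s hE] : exists s : nat, h = k%:Z - s.+1%:Z.
  by exists `|(k%:Z - h - 1)%R|%N; lia.
have sE : k%:Z - h - 1 = s by lia.
rewrite sE absz_nat subSS subn0.
(* Large enough for every [l <= k] at once. *)
pose N := (m + k + s + n)%N.
rewrite (gen_fun_distinct _ n N) -/q; last by rewrite /N; lia.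
have sorted_N la : la \in subseqs (rev (iota 1 N)) -> sorted gtn la.
  by rewrite mem_subseqs subseq_rev_iota1 => /and3P[].
rewrite big_mkcond (eq_big_seq _ (fun la la_N =>
  sum_fixed_hook _ _ _ _ _ _ (q ^+ sumn la) hE (sorted_N la la_N))).
under eq_bigr do rewrite big_mkcond.
rewrite exchange_big /= !fcoef_sum.
have le_uk : (uphalf k.+1 <= k.+1)%N by rewrite leq_uphalf_double; lia.
rewrite (big_cat_nat _ le_uk) // -[RHS]add0r; congr (_ + _).
  (* Below the stated range [k - l > l - 1]: the leg needs more distinct parts than its interval
     contains. *)
  rewrite big_nat big1 // => l /andP[l_gt0 lt_lk].
  rewrite -big_mkcond fcoef_sum_subseqs_row; [|lia|rewrite /N; lia].
  by rewrite sum_subseqs_size_gt ?mulr0 ?mul0r // size_rev size_iota; lia.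
apply: eq_big_nat => l /andP[le_kl lt_lk].
rewrite -big_mkcond fcoef_sum_subseqs_row; [|lia|rewrite /N; lia].
have le_kl' : (k - l <= l.-1)%N by lia.
rewrite sum_subseqs_size_qbinom // -subn1.
have -> : k%:Z - h = s.+1 by lia.
have -> : k%:Z - l%:Z = (k - l)%N by lia.
rewrite !binom2_nat.
set e := (X in q ^ X).
(* The integer exponent is a natural number: the minimal weights of the parts above and of the leg,
   plus the hook row itself. *)
suff -> : e = ((m + l).+1 * s + 'C(s, 2) + (m + l) +
               (m.+1 * (k - l) + 'C(k - l, 2)))%N.
  by rewrite -exprnP !exprD; congr (fcoef _ n); ring.
have [r kE] : exists r, k = (l + r)%N by exists (k - l)%N; lia.
rewrite /e binS bin1 hE kE addKn; lia.
Qed.
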